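(* For every integer $d \ge 1$, $f(d+2) \ge 2 f(d)$; that is, for any acute set $X \subset \mathbb{R}^d$ there exists an acute set $Y \subset \mathbb{R}^{d+2}$ with $|Y| = 2|X|$.
   Context: A set of points in $\mathbb{R}^d$ is called acute if any three distinct points of the set form an acute triangle, i.e. for any three distinct points $x,y,z$ of the set all three angles of the triangle $xyz$ are strictly less than $\pi/2$ (equivalently, $\langle y-x, z-x\rangle > 0$ for all choices of three distinct points $x,y,z$ in the set). Sets with fewer than three points are acute vacuously. $f(d)$ denotes the maximum size of an acute set in $\mathbb{R}^d$ (this maximum is known to be finite). *)

(* Defs.v *)
From HB Require Import structures.
From mathcomp Require Import all_boot all_order all_algebra.
From mathcomp Require Import all_classical all_reals all_analysis.

Set Implicit Arguments.
Unset Strict Implicit.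
Unset Printing Implicit Defensive.

Import Order.TTheory GRing.Theory Num.Theory.

Local Open Scope classical_set_scope.
Local Open Scope card_scope.
Local Open Scope ring_scope.

Definition dotp (R : realType) (d : nat) (u v : 'rV[R]_d) : R :=
  \sum_(i < d) u 0 i * v 0 i.

(* Not the library's `|u|, which on 'rV[R]_d is the sup norm. *)
Definition enorm (R : realType) (d : nat) (u : 'rV[R]_d) : R :=
  Num.sqrt (dotp u u).

(* The angle at x; meaningful when y and z differ from x. *)
Definition angle (R : realType) (d : nat) (x y z : 'rV[R]_d) : R :=
  acos (dotp (y - x) (z - x) / (enorm (y - x) * enorm (z - x))).

(* Only the angle at x is mentioned, since the quantifiers range over all
   orderings of a triple. A collinear triple has an angle pi, so it is
   excluded. *)
Definition acute (R : realType) (d : nat) (X : set 'rV[R]_d) : Prop :=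
  forall x y z, X x -> X y -> X z -> x != y -> y != z -> z != x ->
    angle x y z < pi / 2.

Definition acute_sizes (R : realType) (d : nat) : set nat :=
  [set n | exists X : set 'rV[R]_d, acute X /\ X #= `I_n].

(* The greatest element of acute_sizes R d; the default 0 would be returned
   only if there were none. One exists: acute sets in dimension d have bounded
   size, and an infinite one would contain acute sets of every finite size. *)
Definition max_acute (R : realType) (d : nat) : nat :=
  xget 0%N [set n | acute_sizes R d n /\
                    forall m, acute_sizes R d m -> (m <= n)%N].

(* Main.v *)
Require Import Defs.
From HB Require Import structures.
From mathcomp Require Import all_boot all_order all_algebra.
From mathcomp Require Import all_classical all_reals all_analysis.
From mathcomp Require Import ring lra.

Import Order.TTheory GRing.Theory Num.Theory.

Local Open Scope classical_set_scope.
Local Open Scope card_scope.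
Local Open Scope ring_scope.

Set Implicit Arguments.
Unset Strict Implicit.
Unset Printing Implicit Defensive.

(** The angle at [x] is less than a right angle exactly when
[dotp (y - x) (z - x)] is positive ([acuteP]), so everything below is about
signs of dot products.

Acute sets are finite. For a sign vector [s], say that [p] precedes [q] when
every coordinate grows or decreases from [p] to [q] as [s] prescribes; any two
points are comparable for some [s]. If [p], [q], [r] is a chain of distinct
points for one [s], then [q] lies in the box with opposite corners [p] and
[r], and the angle at [q] is at least a right angle. So in an acute set no
chain has three points. Colour [p] by the set of all [s] for which something
in the set lies above [p]: two points [p], [q] of the same colour, with [q]
above [p] for some [s], would have a point above [q] for the same [s], giving
a chain of three. Hence the colouring is injective and an acute set has at
most 2^(2^d) points ([acute_card_le]), so that the maximum exists
([max_acuteP]).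

Doubling ([lift_pm_acute], [acute_doubling]). Replace each [x] in [X] by the
two points [(x, w x)] and [(x, - w x)], where the [w x] lie on a small circle
in the plane about the origin, pairwise neither equal nor opposite. A triple
over three distinct points of [X] is a small perturbation of an acute triple,
and finitely many triples leave room for it. In a triple [(x, u)], [(x, - u)],
[(y, v)] with [|u| = |v|], the dot product at [(y, v)] is
[|x - y|^2 + |v|^2 - |u|^2 = |x - y|^2 > 0], and the one at [(x, u)] is
[2 (|u|^2 - <u, v>)], positive by the strict Cauchy-Schwarz inequality. *)

(** * The dot product and acute angles *)

Section DotProduct.
Variables (R : realType) (d : nat).
Implicit Types (u v w : 'rV[R]_d) (a : R).

Lemma dotpC u v : dotp u v = dotp v u.
Proof. by apply: eq_bigr => i _; rewrite mulrC. Qed.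

Lemma dotpBl u v w : dotp (u - v) w = dotp u w - dotp v w.
Proof. by rewrite /dotp -sumrB; apply: eq_bigr => i _; rewrite !mxE mulrBl. Qed.

Lemma dotpBr u v w : dotp w (u - v) = dotp w u - dotp w v.
Proof. by rewrite dotpC dotpBl !(dotpC w). Qed.

Lemma dotpZl a u v : dotp (a *: u) v = a * dotp u v.
Proof.
by rewrite /dotp mulr_sumr; apply: eq_bigr => i _; rewrite mxE mulrA.
Qed.

Lemma dotpZr a u v : dotp u (a *: v) = a * dotp u v.
Proof. by rewrite dotpC dotpZl dotpC. Qed.

Lemma dotp0l v : dotp 0 v = 0.
Proof. by rewrite -(scale0r 0) dotpZl mul0r. Qed.

Lemma dotpvv_ge0 u : 0 <= dotp u u.
Proof. by apply: sumr_ge0 => i _; rewrite -expr2 sqr_ge0. Qed.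

Lemma dotpvv_gt0 u : u != 0 -> 0 < dotp u u.
Proof.
move=> u0; rewrite lt0r dotpvv_ge0 andbT; apply: contra u0.
rewrite psumr_eq0 => [/allP /= u0|i _]; last by rewrite -expr2 sqr_ge0.
apply/eqP/rowP => i; rewrite mxE; apply/eqP.
by have := u0 i (mem_index_enum i); rewrite mulf_eq0 orbb.
Qed.

(** Expand the squared norm of [dotp v v *: u - dotp u v *: v]. *)
Lemma cauchy_schwarz u v : dotp u v ^+ 2 <= dotp u u * dotp v v.
Proof.
have [->|v0] := eqVneq v 0.
  by rewrite dotpC !dotp0l mulr0 expr0n.
have v_gt0 := dotpvv_gt0 v0.
have := dotpvv_ge0 (dotp v v *: u - dotp u v *: v).
rewrite dotpBl !dotpBr !dotpZl !dotpZr (dotpC v u) => sq_ge0.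
rewrite -subr_ge0 -(pmulr_rge0 _ v_gt0).
by congr (0 <= _): sq_ge0; ring.
Qed.

End DotProduct.

Lemma dotp_row_mx (R : realType) (m n : nat)
    (u u' : 'rV[R]_m) (v v' : 'rV[R]_n) :
  dotp (row_mx u v) (row_mx u' v') = dotp u u' + dotp v v'.
Proof.
rewrite /dotp big_split_ord /=; congr (_ + _); apply: eq_bigr => i _.
  by rewrite !row_mxEl.
by rewrite !row_mxEr.
Qed.

(** The Cauchy-Schwarz inequality puts the quotient in [-1, 1], the interval on
which [acos] inverts the decreasing function [cos]. *)
Lemma angle_lt_pihalf (R : realType) (d : nat) (x y z : 'rV[R]_d) :
  y != x -> z != x -> (angle x y z < pi / 2) = (0 < dotp (y - x) (z - x)).
Proof.
move=> yx zx; rewrite /angle /enorm.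
have u_gt0 : 0 < dotp (y - x) (y - x) by rewrite dotpvv_gt0 // subr_eq0.
have v_gt0 : 0 < dotp (z - x) (z - x) by rewrite dotpvv_gt0 // subr_eq0.
have CS := cauchy_schwarz (y - x) (z - x).
move: (dotp (y - x) (z - x)) CS => b CS.
set n := Num.sqrt _ * Num.sqrt _.
have n_gt0 : 0 < n by rewrite mulr_gt0 // sqrtr_gt0.
have n2 : b ^+ 2 <= n ^+ 2 by rewrite exprMn !sqr_sqrtr //; apply: ltW.
have t1 : -1 <= b / n <= 1.
  rewrite ler_pdivlMr // ler_pdivrMr // mul1r mulN1r -ler_norml.
  by rewrite -(ger0_norm (ltW n_gt0)) -ler_sqr // !real_normK ?num_real.
have [? acosE] := acos_def t1.
rewrite -ltr_cos ?in_itv //=; last by have := pi_gt0 R; lra.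
by rewrite acosE cos_pihalf pmulr_lgt0 // invr_gt0.
Qed.

Lemma acuteP (R : realType) (d : nat) (X : set 'rV[R]_d) :
  acute X <-> forall x y z, X x -> X y -> X z -> x != y -> y != z -> z != x ->
    0 < dotp (y - x) (z - x).
Proof.
split=> acX x y z Xx Xy Xz xy yz zx.
  by rewrite -angle_lt_pihalf ?acX // eq_sym.
by rewrite angle_lt_pihalf ?acX // eq_sym.
Qed.

(** * Acute sets are finite *)

Section Finiteness.
Variables (R : realType) (d : nat).
Implicit Types (X : set 'rV[R]_d) (s : {ffun 'I_d -> bool}).

Definition orthant_le s (p q : 'rV[R]_d) : Prop :=
  forall i, if s i then p 0 i <= q 0 i else q 0 i <= p 0 i.

Lemma orthant_le_exists (p q : 'rV[R]_d) : exists s, orthant_le s p q.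
Proof.
exists [ffun i => p 0 i <= q 0 i] => i; rewrite ffunE.
by case: ifPn => //; rewrite -ltNge => /ltW.
Qed.

Lemma orthant_le_anti s (p q : 'rV[R]_d) :
  orthant_le s p q -> orthant_le s q p -> p = q.
Proof.
move=> pq qp; apply/rowP => i; apply/le_anti/andP.
by move: (pq i) (qp i); case: (s i).
Qed.

(** Each coordinate of [q] lies between those of [p] and [r], so every term of
[dotp (p - q) (r - q)] is nonpositive. *)
Lemma acute_no_orthant_chain X s p q r : acute X -> X p -> X q -> X r ->
  p != q -> q != r -> orthant_le s p q -> orthant_le s q r -> False.
Proof.
move=> /acuteP acX Xp Xq Xr npq nqr pq qr.
have [rp|nrp] := eqVneq r p.
  by move: npq; rewrite -rp eq_sym (orthant_le_anti qr) ?rp ?eqxx.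
have := acX q r p Xq Xr Xp nqr nrp npq.
apply/negP; rewrite -leNgt; apply: sumr_le0 => i _; rewrite !mxE.
by move: (pq i) (qr i); case: (s i) => ? ?; nra.
Qed.

(** The colour of [p]: the orthants whose translate to [p] contains another
point of [X]. *)
Definition dominated_orthants X (p : 'rV[R]_d) : {set {ffun 'I_d -> bool}} :=
  [set s | `[< exists q, [/\ X q, p != q & orthant_le s p q] >]]%SET.

(** Distinct [p] and [q] of one colour are comparable for some [s], which then
belongs to the colour of [q] and extends the pair to a chain of three. *)
Lemma dominated_orthants_inj X : acute X ->
  {in X &, injective (dominated_orthants X)}.
Proof.
move=> acX p q /set_mem Xp /set_mem Xq eqpq; apply/eqP/negPn/negP => npq.
have [s pq] := orthant_le_exists p q.
have : s \in dominated_orthants X p by rewrite inE; apply/asboolP; exists q.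
rewrite eqpq inE => /asboolP[r [Xr nqr qr]].
exact: acute_no_orthant_chain acX Xp Xq Xr npq nqr pq qr.
Qed.

Lemma acute_card_le X : acute X -> X #<= `I_#|{set {ffun 'I_d -> bool}}|.
Proof.
move=> acX; pose f p : nat := enum_rank (dominated_orthants X p).
have fI : {in X &, injective f}.
  move=> p q Xp Xq /ord_inj /enum_rank_inj.
  exact: dominated_orthants_inj.
rewrite -(card_le_eql (inj_card_eq fI)); apply: subset_card_le.
by move=> _ [p _ <-]; rewrite /= ltn_ord.
Qed.

Lemma acute_finite X : acute X -> finite_set X.
Proof. by move=> /acute_card_le /card_le_finite; apply. Qed.

Lemma acute_sizes0 : acute_sizes R d 0.
Proof. by exists set0; split=> [x y z []|]; rewrite II0. Qed.

Lemma max_acuteP : acute_sizes R d (max_acute R d) /\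
  forall m, acute_sizes R d m -> (m <= max_acute R d)%N.
Proof.
apply: (@xgetPex _ 0%N [set n | acute_sizes R d n /\
  forall m, acute_sizes R d m -> (m <= n)%N]).
have size0 : exists n, `[< acute_sizes R d n >].
  by exists 0%N; apply/asboolP/acute_sizes0.
have size_le n : `[< acute_sizes R d n >] ->
    (n <= #|{set {ffun 'I_d -> bool}}|)%N.
  move=> /asboolP[X [/acute_card_le Xle Xn]].
  by rewrite -card_le_II -(card_le_eql Xn).
have [n /asboolP nP nmax] := ex_maxnP size0 size_le.
by exists n; split=> // m mP; apply: nmax; apply/asboolP.
Qed.

End Finiteness.

(** * Points of the unit circle, pairwise neither equal nor opposite *)

Section Circle.
Variable R : realType.
Implicit Types s t : R.

(** The rational parametrization by the tangent of the half angle: distinct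
nonnegative parameters give angles in [0, pi), hence points that are neither
equal nor opposite. *)
Definition circle t : 'rV[R]_2 :=
  \row_(j < 2) ((if j == 0 then 1 - t ^+ 2 else t *+ 2) / (1 + t ^+ 2)).

Lemma dotp_circle s t : dotp (circle s) (circle t) =
  ((1 - s ^+ 2) * (1 - t ^+ 2) + 4 * (s * t)) / ((1 + s ^+ 2) * (1 + t ^+ 2)).
Proof.
rewrite /dotp big_ord_recl big_ord1 !mxE /=.
have : 1 + s ^+ 2 != 0 by rewrite gt_eqF // ltr_pwDl // sqr_ge0.
have : 1 + t ^+ 2 != 0 by rewrite gt_eqF // ltr_pwDl // sqr_ge0.
by move=> ? ?; field; apply/andP.
Qed.

Lemma dotp_circle_diag t : dotp (circle t) (circle t) = 1.
Proof.
rewrite dotp_circle.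
have : 1 + t ^+ 2 != 0 by rewrite gt_eqF // ltr_pwDl // sqr_ge0.
by move=> ?; field.
Qed.

Lemma dotp_circle_lt1 s t : 0 <= s -> 0 <= t -> s != t ->
  `|dotp (circle s) (circle t)| < 1.
Proof.
move=> s0 t0 st; rewrite dotp_circle ltr_norml.
have s_gt0 : 0 < 1 + s ^+ 2 by rewrite ltr_pwDl // sqr_ge0.
have t_gt0 : 0 < 1 + t ^+ 2 by rewrite ltr_pwDl // sqr_ge0.
have st2 : 0 < (s - t) ^+ 2 by rewrite exprn_even_gt0 //= subr_eq0.
have st1 : 0 < (1 + s * t) ^+ 2 by rewrite exprn_gt0 // ltr_pwDl // mulr_ge0.
(* The two margins, up to a positive factor, are twice [(s - t) ^+ 2] and twice
[(1 + s * t) ^+ 2]. *)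
rewrite ltr_pdivlMr ?ltr_pdivrMr ?mulr_gt0 //; apply/andP; split; nra.
Qed.

End Circle.

(** * Doubling *)

Lemma finite_pos_gap (R : realType) (T : eqType) (A : set T) (f : T -> R) :
  finite_set A -> exists2 e, 0 < e & forall t, A t -> 0 < f t -> e <= f t.
Proof.
move=> /finite_seqP[s ->]; elim: s => [|a s [e e0 es]]; first by exists 1.
have [fa|fa] := ltP 0 (f a); last first.
  exists e => // t /=; rewrite inE => /orP[/eqP->|]; last exact: es.
  by rewrite ltNge fa.
exists (Num.min e (f a)); first by rewrite lt_min e0 fa.
move=> t /=; rewrite inE => /orP[/eqP-> _|ts ft].
  by rewrite ge_min lexx orbT.
by rewrite ge_min es.
Qed.

Section Doubling.
Variables (R : realType) (d k : nat) (w : 'rV[R]_d -> 'rV[R]_k).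

Definition lift_pm (p : 'rV[R]_d * bool) : 'rV[R]_(d + k) :=
  row_mx p.1 ((-1) ^+ p.2 *: w p.1).

Lemma dotp_lift_pm p q r :
  let g (s t : 'rV[R]_d * bool) :=
    (-1) ^+ s.2 * ((-1) ^+ t.2 * dotp (w s.1) (w t.1)) in
  dotp (lift_pm q - lift_pm p) (lift_pm r - lift_pm p) =
  dotp (q.1 - p.1) (r.1 - p.1) + (g q r - g q p - (g p r - g p p)).
Proof.
rewrite /= /lift_pm !opp_row_mx !add_row_mx dotp_row_mx; congr (_ + _).
by rewrite dotpBl !dotpBr !dotpZl !dotpZr.
Qed.

(* The vectors [w x] have the same squared norm [e] and are pairwise neither
equal nor opposite. Moving three points over distinct [x], [y], [z] by such
vectors lowers a dot product by less than [e *+ 2]: of the four terms that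
appear, three exceed [- e] and the fourth is [dotp (w x) (w x) = e]. *)
Variables (X : set 'rV[R]_d) (e : R).
Hypothesis e_gt0 : 0 < e.
Hypothesis w_norm : forall x, X x -> dotp (w x) (w x) = e.
Hypothesis w_lt : forall x y, X x -> X y -> x != y -> `|dotp (w x) (w y)| < e.
Hypothesis gap : forall x y z, X x -> X y -> X z ->
  x != y -> y != z -> z != x -> e *+ 2 <= dotp (y - x) (z - x).

Lemma lift_pm_inj : {in X `*` [set: bool] &, injective lift_pm}.
Proof.
move=> [x b] [y c] /set_mem[/= Xx _] _ /eq_row_mx[/= <-].
case: b c => [] [] //= /(congr1 (dotp (w x))); rewrite !dotpZr w_norm //;
  rewrite expr0 expr1 => ?; exfalso; move: e_gt0; lra.
Qed.

(** Over at most two points of [X] the dot product is [2 (|u|^2 - <u, v>)] or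
[|x - y|^2], according to whether the angle is at one of the two points over
the same [x] or at the third point; over three points the gap hypothesis
absorbs the perturbation. In every case it remains to substitute the eight
sign patterns. *)
Lemma lift_pm_acute : acute (lift_pm @` (X `*` [set: bool])).
Proof.
apply/acuteP => _ _ _ [[x b] [/= Xx _] <-] [[y c] [/= Xy _] <-]
  [[z a] [/= Xz _] <-].
have lift_neq p q : lift_pm p != lift_pm q -> p != q by apply: contra_neq => ->.
move=> /lift_neq pq /lift_neq qr /lift_neq rp.
rewrite dotp_lift_pm /= !w_norm //.
have [exy|nxy] := eqVneq x y.
  rewrite -exy in pq qr *; rewrite subrr dotp0l w_norm //.
  have nxz : x != z.
    apply/eqP => exz; move: pq qr rp.
    by rewrite -exz !xpair_eqE eqxx; case: a b c => [] [] [].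
  move: (w_lt Xx Xz nxz); rewrite ltr_norml => /andP[? ?].
  move: pq {qr rp}; rewrite xpair_eqE eqxx.
  by case: a b c => [] [] [] //= _; lra.
have [ezx|nzx] := eqVneq z x.
  rewrite ezx in rp qr *; rewrite subrr (dotpC (_ - _)) dotp0l w_norm //.
  move: (w_lt Xx Xy nxy); rewrite ltr_norml => /andP[? ?].
  rewrite (dotpC (w y)); move: rp {pq qr}; rewrite xpair_eqE eqxx.
  by case: a b c => [] [] [] //= _; lra.
move: (w_lt Xx Xy nxy); rewrite ltr_norml => /andP[? ?].
have nxz : x != z by rewrite eq_sym.
move: (w_lt Xx Xz nxz); rewrite ltr_norml => /andP[? ?].
have [eyz|nyz] := eqVneq y z.
  rewrite -eyz in qr *; rewrite w_norm //.
  have : 0 < dotp (y - x) (y - x) by rewrite dotpvv_gt0 // subr_eq0 eq_sym.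
  rewrite (dotpC (w y)); move: qr {pq rp}; rewrite xpair_eqE eqxx.
  by case: a b c => [] [] [] //= _ ?; lra.
move: (w_lt Xy Xz nyz); rewrite ltr_norml => /andP[? ?].
have := gap Xx Xy Xz nxy nyz nzx.
rewrite (dotpC (w y) (w x)); clear pq qr rp.
by case: a b c => [] [] [] /= ?; lra.
Qed.

End Doubling.

(** The vectors [w x] are taken on the circle whose squared radius is half a
positive lower bound of the dot products over triples, with the position of
[x] in an enumeration of [X] as parameter. *)
Lemma acute_doubling (R : realType) (d : nat) (X : set 'rV[R]_d) : acute X ->
  exists Y : set 'rV[R]_(d + 2), acute Y /\ Y #= X `*` [set: bool].
Proof.
move=> acX; have finX := acute_finite acX.
pose f (t : 'rV[R]_d * 'rV[R]_d * 'rV[R]_d) :=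
  dotp (t.1.2 - t.1.1) (t.2 - t.1.1).
have [D D_gt0 Dgap] : exists2 D : R, 0 < D &
    forall t, (X `*` X `*` X) t -> 0 < f t -> D <= f t.
  by apply: finite_pos_gap; do 2 (apply: finite_setX => //).
have /finite_seqP[s Xs] := finX.
pose w x := Num.sqrt (D / 2) *: circle (index x s)%:R.
have ww x y : dotp (w x) (w y) =
    D / 2 * dotp (circle (index x s)%:R) (circle (index y s)%:R).
  by rewrite dotpZl dotpZr mulrA -expr2 sqr_sqrtr // divr_ge0 // ltW.
have e_gt0 : 0 < D / 2 by rewrite divr_gt0.
have w_norm x : X x -> dotp (w x) (w x) = D / 2.
  by rewrite ww dotp_circle_diag mulr1.
have w_lt x y : X x -> X y -> x != y -> `|dotp (w x) (w y)| < D / 2.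
  rewrite Xs /= => xs ys nxy; rewrite ww normrM gtr0_norm // gtr_pMr //.
  apply: dotp_circle_lt1; rewrite ?ler0n // eqr_nat.
  by apply: contra nxy => /eqP/index_inj ->.
exists (lift_pm w @` (X `*` [set: bool])); split.
  apply: (lift_pm_acute w_norm w_lt) => x y z Xx Xy Xz xy yz zx.
  rewrite -[X in X <= _]mulr_natr divfK ?pnatr_eq0 //.
  by apply: (Dgap (x, y, z)) => //=; move/acuteP: acX; apply.
exact: inj_card_eq (lift_pm_inj e_gt0 w_norm).
Qed.

Lemma card_setX_bool (T : Type) (A : set T) n :
  A #= `I_n -> A `*` [set: bool] #= `I_(2 * n).
Proof.
move=> /card_set_bijP[f [fn fI fS]]; apply/card_set_bijP.
exists (fun p : T * bool => (p.2 + (f p.1).*2)%N); split.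
- move=> [x b] [/= /fn /= fx _]; rewrite mul2n.
  by apply: (@leq_trans (f x).+1.*2); [case: b | rewrite leq_double].
- move=> [x b] [y c] /set_mem[/= Ax _] /set_mem[/= Ay _] fxy.
  (* The parity of the code recovers the boolean. *)
  have bc : b = c.
    by have := congr1 odd fxy; rewrite !oddD !odd_double !addbF !oddb.
  move: fxy; rewrite bc => /addnI/double_inj/fI ->//; exact: mem_set.
- move=> m /= mn; have [|x Ax fx] := fS m./2.
    by rewrite /= ltn_half_double -mul2n.
  by exists (x, odd m) => //=; rewrite fx odd_double_half.
Qed.

Theorem theorem1 (R : realType) (d : nat) (hd : (1 <= d)%N) :
  (2 * max_acute R d <= max_acute R (d + 2))%N /\
  (forall X : set 'rV[R]_d, acute X ->
     exists Y : set 'rV[R]_(d + 2), acute Y /\ Y #= X `*` [set: bool]).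
Proof.
split; last exact: acute_doubling.
have [[X [acX Xn]] _] := max_acuteP R d.
have [Y [acY YX]] := acute_doubling acX.
apply: (max_acuteP R (d + 2)).2; exists Y; split=> //.
exact: card_eq_trans YX (card_setX_bool Xn).
Qed.
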